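(* For every integer $t \geq 2$, there exists a constant $c_t > 0$ (depending only on $t$) such that, for every integer $k \geq 2$, \[R_2(t; k) \leq \mathrm{twr}_{r - 1}(c_t\, k \log k),\] where $r = 2^{t - 1}$.
   Context: $\mathrm{PG}(n-1,2)$ denotes the projective space of $\mathbb{F}_2^n$; its points are identified with the nonzero vectors of $\mathbb{F}_2^n$. A $(t-1)$-dimensional projective subspace (also called a $(t-1)$-flat) of $\mathrm{PG}(n-1,2)$ is the set of nonzero vectors of a $t$-dimensional linear subspace of $\mathbb{F}_2^n$. For integers $t,k \geq 1$, the multicolor vector space Ramsey number $R_2(t;k)$ is the least integer $n$ such that every $k$-coloring of the points of $\mathrm{PG}(n-1,2)$ (i.e. every assignment of one of $k$ colors to each point) contains a monochromatic $(t-1)$-dimensional projective subspace. The tower function is defined by $\mathrm{twr}_1(x) = x$ and $\mathrm{twr}_i(x) = 2^{\mathrm{twr}_{i-1}(x)}$ for $i \geq 2$. $\log$ denotes the base-two logarithm. *)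

(* Defs.v *)
From mathcomp Require Import all_boot all_order all_algebra.
From mathcomp Require Import reals exp.

Set Implicit Arguments.
Unset Strict Implicit.
Unset Printing Implicit Defensive.

Import Order.TTheory GRing.Theory Num.Theory.
Local Open Scope ring_scope.

(* Points of PG(n-1,2): over F_2 every line through 0 has exactly one nonzero
   vector. *)
Definition pg_point (n : nat) : Type := {v : 'rV['F_2]_n | v != 0}.

(* The index t is the linear dimension; the flat has projective dimension
   t - 1. *)
Definition is_flat (n t : nat) (F : pred (pg_point n)) : Prop :=
  exists2 U : {vspace 'rV['F_2]_n},
    \dim U = t & forall p : pg_point n, F p = (val p \in U).

Definition monochromatic (n k : nat) (chi : pg_point n -> 'I_k)
    (F : pred (pg_point n)) : Prop :=
  exists c : 'I_k, forall p : pg_point n, F p -> chi p = c.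

Definition vs_ramsey_property (t k n : nat) : Prop :=
  forall chi : pg_point n -> 'I_k,
  exists2 F : pred (pg_point n), is_flat t F & monochromatic chi F.

(* [is_vs_ramsey_number t k N] says that R_2(t;k) exists and equals N. *)
Definition is_vs_ramsey_number (t k N : nat) : Prop :=
  vs_ramsey_property t k N /\
  forall n : nat, vs_ramsey_property t k n -> (N <= n)%N.

Definition log2 (R : realType) (x : R) : R := ln x / ln 2.

(* twr_1(x) = x and twr_(i+1)(x) = 2^(twr_i(x)); the value at the index 0, where
   the tower function is not defined, is x. *)
Definition twr (R : realType) (i : nat) (x : R) : R :=
  iter i.-1 (fun y : R => 2 `^ y) x.

(* Main.v *)
(* Put r = 2^(t-1) and colour the r-element sets of vectors of F_2^n by the
   colour of their sum, with one extra colour for the sum 0.  The Erdos-Rado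
   bound for r-uniform hypergraphs with k + 1 colours gives, as soon as 2^n
   exceeds a tower of height r over C k log k, a set of 2^t vectors x_v, indexed
   by v in F_2^t, all of whose r-sums have the same colour; this colour is not
   the extra one.  The simplex code then yields the flat: for every nonzero a in
   F_2^t exactly r vectors v satisfy <a, v> = 1, so the image of the linear map
   a |-> sum_v <a, v> x_v consists, apart from 0, of such r-sums. *)
Require Import Defs.
From mathcomp Require Import all_boot all_order all_algebra zify boolp.
From mathcomp Require Import reals exp.

Set Implicit Arguments.
Unset Strict Implicit.
Unset Printing Implicit Defensive.

Import Order.TTheory GRing.Theory Num.Theory.

(** * Pigeonhole and subsequences *)

Lemma seq_pigeonhole (V : Type) (T : finType) (h : V -> T) (t0 : T)
    (s : seq V) (m : nat) :
  m * #|T| <= size s -> exists t, m <= count (fun x => h x == t) s.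
Proof.
move=> le_s; have T_gt0 : 0 < #|T| by apply/card_gt0P; exists t0.
case: [arg max_(t > t0) count (fun x => h x == t) s]/arg_maxnP => // t _ max_t.
exists t; rewrite -(leq_pmul2r T_gt0); apply: leq_trans le_s _.
have -> : size s = \sum_t count (fun x => h x == t) s.
  elim: s {max_t} => [|x s IHs] /=; first by rewrite big1.
  rewrite big_split /= -IHs (bigD1 (h x)) //= eqxx big1 ?addn0 ?add1n //.
  by move=> u /negbTE; rewrite eq_sym => ->.
by rewrite mulnC -sum_nat_const; apply: leq_sum => u _; apply: max_t.
Qed.

Lemma subseq_rcons_split (V : eqType) (l : seq V) (x : V) (s : seq V) :
  subseq (rcons l x) s -> exists u v, s = u ++ x :: v /\ subseq l u.
Proof.
elim: s l => [|y s IHs] [|z l] //=.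
- case: eqP => [<- _|_ /(IHs [::])[u [v [-> _]]]]; first by exists [::], s.
  by exists (y :: u), v.
- case: eqP => [<-|ne_zy].
    by case/IHs=> u [v [-> sub_lu]]; exists (z :: u), v; rewrite /= eqxx.
  case/(IHs (z :: l)) => u [v [-> sub_lu]]; exists (y :: u), v; split=> //.
  by apply: subseq_trans sub_lu _; apply: subseq_cons.
Qed.

(** * Ramsey bounds for uniform hypergraphs *)

(** Edges are subsequences of a duplicate-free sequence: each [r]-set is met in one order only, so
    [f] need not be symmetric. *)
Definition hypergraph_ramsey (r m q N : nat) : Prop :=
  forall (V : eqType) (T : finType) (f : seq V -> T) (s : seq V),
    #|T| <= q -> uniq s -> N <= size s ->
  exists s' c, [/\ subseq s' s, size s' = m &
    forall l, subseq l s' -> size l = r -> f l = c].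

Lemma hypergraph_ramseyW (r m q N N' : nat) :
  N <= N' -> hypergraph_ramsey r m q N -> hypergraph_ramsey r m q N'.
Proof.
move=> leN ramN V T f s leT Us leN's.
by apply: ramN => //; apply: leq_trans leN's.
Qed.

Lemma hypergraph_ramsey1 (m q : nat) : hypergraph_ramsey 1 m q (m * q).
Proof.
move=> V T f s leT Us le_s.
have [|c le_c] := @seq_pigeonhole V T (fun x => f [:: x]) (f [::]) s m.
  by apply: leq_trans le_s; rewrite leq_mul2l leT orbT.
exists (take m [seq x <- s | f [:: x] == c]), c; split.
- exact: subseq_trans (take_subseq _ _) (filter_subseq _ _).
- by rewrite size_takel // size_filter.
move=> [|x []] // /mem_subseq/(_ x); rewrite inE eqxx => /(_ isT)/mem_take.
by rewrite mem_filter => /andP[/eqP].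
Qed.

(* Only the tuples ending in the newly chosen point [x] are tested at each step:
   this is what keeps the exponent linear in [q] for graphs. *)
Lemma end_homogeneous_extension (V : eqType) (T : finType) (f : seq V -> T)
    (r K M : nat) (p A : seq V) :
  uniq A -> size p + M <= K -> (2 * #|T| ^ (K ^ r)) ^ M <= size A ->
  exists s' (g : seq V -> T), [/\ subseq s' A, size s' = M &
    forall u x v z l, s' = u ++ x :: v -> z \in v ->
      {subset l <= p ++ u} -> size l = r ->
      f (rcons (rcons l x) z) = g (rcons l x)].
Proof.
elim: M p A => [|M IHM] p A UA le_pM.
  by exists [::], (fun=> f [::]); split=> //; [rewrite sub0seq | case].
have T_gt0 : 0 < #|T| by apply/card_gt0P; exists (f [::]).
set W := #|T| ^ _ in IHM *.
have W_gt0 : 0 < W by rewrite expn_gt0 T_gt0.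
case: A UA => [|x A] /=; first by rewrite leqNgt expn_gt0 muln_gt0 W_gt0.
move=> /andP[xNA UA] le_A.
(* A pattern is indexed by [r]-tuples of positions in [p]; since [size p <= K], at most [W] patterns
   occur. *)
pose pat y := [ffun tau : r.-tuple 'I_(size p) =>
  f (rcons (rcons [seq nth x p (i : 'I__) | i <- tau] x) y)].
have [|c le_c] := @seq_pigeonhole V _ pat (pat x) A ((2 * W) ^ M).
  rewrite card_ffun card_tuple card_ord.
  apply: (@leq_trans ((2 * W) ^ M * W)).
    rewrite leq_mul2l; apply/orP; right.
    rewrite leq_pexp2l //; have [->|r_gt0] := posnP r; first by [].
    by rewrite leq_exp2r //; lia.
  (* The factor 2 pays for the point [x] taken out of [A]: 2WX - 1 >= WX. *)
  have WM_gt0 : 0 < (2 * W) ^ M by rewrite expn_gt0 muln_gt0 W_gt0.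
  move: le_A; rewrite expnS; move: ((2 * W) ^ M) WM_gt0 => X X_gt0.
  by have : 0 < X * W by [rewrite muln_gt0 X_gt0]; lia.
have [||s1 [g1 [sub1 sz1 hom1]]] :=
    IHM (rcons p x) [seq y <- A | pat y == c] (filter_uniq _ UA).
- by rewrite size_rcons; lia.
- by rewrite size_filter.
have sub1A : subseq s1 A by apply: subseq_trans sub1 (filter_subseq _ _).
(* All points of [s1] share one pattern, so its first point serves as test point for lists ending in
   [x]. Since [x] is not in [s1], the other lists can safely be left to [g1]; the default of [head]
   only occurs when no later point exists. *)
exists (x :: s1),
  (fun l => if last x l == x then f (rcons l (head x s1)) else g1 l).
split; [by rewrite /= eqxx | by rewrite /= sz1 |].
move=> [|y u] x' v z l /= [].
  move=> <- <- zs1; rewrite cats0 => lp szl.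
  rewrite last_rcons eqxx.
  case: s1 zs1 sub1 {sz1 hom1 sub1A} => //= z0 s1 zs1 /mem_subseq sub1.
  have patP y : y \in z0 :: s1 -> pat y = c.
    by move/sub1; rewrite mem_filter => /andP[/eqP].
  have : pat z = pat z0 by rewrite !patP ?mem_head.
  have szp y : y \in l -> index y p < size p by move=> /lp; rewrite index_mem.
  (* A list over [p] is recovered from the positions of its entries, so equal patterns give it equal
     colours. *)
  have [tau def_l] : exists tau : r.-tuple 'I_(size p),
      [seq nth x p (i : 'I__) | i <- tau] = l.
    have tP : size (pmap (fun y => insub (index y p) : option 'I_(size p)) l) == r.
      rewrite size_pmap -szl; apply/eqP/eqP; rewrite -all_count.
      by apply/allP=> y /szp lty; rewrite /= insubT.
    exists (Tuple tP) => /=; elim: (l) lp szp => //= y l' IHl lp szp.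
    have lty := szp _ (mem_head _ _).
    rewrite insubT /= nth_index; last by apply: lp; rewrite mem_head.
    by rewrite IHl // => w wl; [apply: lp|apply: szp]; rewrite inE wl orbT.
  by move/ffunP/(_ tau); rewrite !ffunE def_l.
move=> <- def_s1 zv sub_l szl; rewrite last_rcons.
have -> : (x' == x) = false.
  apply: contraNF xNA => /eqP <-; apply: (mem_subseq sub1A).
  by rewrite def_s1 mem_cat mem_head orbT.
by apply: hom1 def_s1 zv _ szl => w /sub_l; rewrite cat_rcons.
Qed.

(** On an end-homogeneous sequence of [N] points the colour of an edge does not depend on its last
    vertex, which leaves a colouring [g] of edges with one vertex fewer. *)
Lemma hypergraph_ramsey_step (r m q L N : nat) :
    0 < L -> q <= 2 ^ L -> 0 < N -> hypergraph_ramsey r.+1 m q N ->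
  hypergraph_ramsey r.+2 m q (2 ^ (2 * L * N ^ r.+1)).
Proof.
move=> L_gt0 leq2L N_gt0 ramN V T f s leT Us le_s.
have [||s1 [g [sub1 sz1 hom1]]] :=
    @end_homogeneous_extension V T f r N N [::] s Us.
- by [].
- apply: leq_trans le_s.
  apply: (@leq_trans ((2 * (2 ^ L) ^ (N ^ r)) ^ N)).
    rewrite leq_exp2r // leq_mul2l leq_exp2r ?expn_gt0 ?N_gt0 //.
    by rewrite (leq_trans leT).
  (* The exponents compare as N(1 + L N^r) <= 2 L N^(r+1). *)
  rewrite -expnM -expnS -expnM leq_pexp2l // expnS.
  have LX_gt0 : 0 < L * N ^ r by rewrite muln_gt0 L_gt0 expn_gt0 N_gt0.
  by rewrite (mulnC N (N ^ r)) !mulnA leq_mul2r -mulnA; lia.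
have [|s2 [c [sub2 sz2 hom2]]] := ramN V T g s1 leT (subseq_uniq sub1 Us).
  by rewrite sz1.
exists s2, c; split=> //; first exact: subseq_trans sub2 sub1.
move=> l; case/lastP: l => // l z; case/lastP: l => // l x sub_l.
rewrite !size_rcons => -[szl].
have sub_lx : subseq (rcons l x) s2.
  by apply: subseq_trans sub_l; apply: subseq_rcons.
rewrite -(hom2 (rcons l x)) ?size_rcons ?szl //.
have [u [v [def_s1 sub_lxu]]] := subseq_rcons_split (subseq_trans sub_l sub2).
have [u1 [u2 [def_u sub_lu]]] := subseq_rcons_split sub_lxu.
apply: (hom1 u1 x (u2 ++ z :: v)) => //.
- by rewrite def_s1 def_u -catA.
- by rewrite mem_cat mem_head orbT.
- exact: mem_subseq sub_lu.
Qed.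

(** * Tower estimates *)

Definition tower (i y : nat) : nat := iter i (expn 2) y.

Lemma leq_tower (i y : nat) : y <= tower i y.
Proof.
by elim: i => //= i IHi; apply: leq_trans IHi (ltnW (ltn_expl _ _)).
Qed.

(** Constant factors move down to the base of the tower, because C 2^T <= 2^(C - 1 + T) <= 2^(C T)
    for C, T >= 1. *)
Lemma mul_tower (i C y : nat) :
  0 < C -> 0 < y -> C * tower i y <= tower i (C * y).
Proof.
move=> C_gt0 y_gt0; elim: i => //= i IHi.
apply: (@leq_trans (2 ^ (C * tower i y))); last by rewrite leq_pexp2l.
have := leq_tower i y; set T := tower i y => leyT.
have leC : C <= 2 ^ C.-1 by have := ltn_expl C.-1 (leqnn 2); lia.
apply: (@leq_trans (2 ^ C.-1 * 2 ^ T)); first by rewrite leq_mul2r leC orbT.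
by rewrite -expnD leq_pexp2l //; nia.
Qed.

(** Each further vertex per edge costs one exponential, starting from an exponent linear in [L * q]
    for graphs. That [C] is chosen before [q] and [L] is what makes the final constant depend on [t]
    alone. *)
Lemma hypergraph_ramsey_tower (r m : nat) : 0 < m ->
  exists2 C, 0 < C & forall q L, 0 < q -> 0 < L -> q <= 2 ^ L ->
    hypergraph_ramsey r.+2 m q (tower r.+1 (C * (L * q))).
Proof.
move=> m_gt0; elim: r => [|r [C C_gt0 IHr]].
  exists (2 * m); first by lia.
  move=> q L q_gt0 L_gt0 leq2L.
  have -> : 2 * m * (L * q) = 2 * L * (m * q) ^ 1 by rewrite expn1; lia.
  apply: hypergraph_ramsey_step => //; first by rewrite muln_gt0 m_gt0.
  exact: hypergraph_ramsey1.
exists (r.+4 * C); first by lia.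
move=> q L q_gt0 L_gt0 leq2L.
have y_gt0 : 0 < C * (L * q) by nia.
have T_gt0 := leq_trans y_gt0 (leq_tower r.+1 _).
have ramT := IHr q L q_gt0 L_gt0 leq2L.
apply: hypergraph_ramseyW (hypergraph_ramsey_step L_gt0 leq2L T_gt0 ramT).
rewrite /=.
rewrite leq_pexp2l // -expnM -mulnA.
apply: (@leq_trans (2 ^ (r.+4 * tower r (C * (L * q))))); last first.
  by rewrite leq_pexp2l // -mulnA mul_tower.
(* With N = 2^T, the exponent 2 L N^(r+2) is at most 2^T 2^T 2^(T(r+2)), whence the factor
   [r.+4]. *)
have := leq_tower r (C * (L * q)); set T := tower r _ => leyT.
have leL : L <= 2 ^ T.
  have leLT : L <= T by apply: leq_trans leyT; rewrite mulnCA leq_pmulr // muln_gt0 C_gt0.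
  exact: leq_trans leLT (ltnW (ltn_expl _ _)).
have -> : r.+4 * T = T + (T + T * r.+2) by lia.
rewrite !expnD mulnA (mulnA (2 ^ T)) leq_mul2r; apply/orP; right.
by rewrite mulnC leq_mul // -{1}(expn1 2) leq_pexp2l //; lia.
Qed.

Local Open Scope ring_scope.

(** * Linear algebra over F_2 *)

Lemma F2_eq_neq0 (x : 'F_2) : x = (x != 0)%:R.
Proof. by case: x => -[|[]] // ?; apply: val_inj. Qed.

(** Translation by a vector [w] with <a, w> = 1 exchanges the two level sets of the functional, so
    each is half of the space. *)
Lemma card_nonzero_functional (t : nat) (a : 'rV['F_2]_t) : a != 0 ->
  #|[pred v : 'rV['F_2]_t | (a *m v^T) 0 0 != 0]| = (2 ^ (t - 1))%N.
Proof.
case: t a => [|t] a a_neq0; first by rewrite (thinmx0 a) eqxx in a_neq0.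
set A := [pred v | _]; rewrite subn1 /=.
have [i ai] : exists i, a 0 i != 0 by apply/rV0Pn.
pose w : 'rV['F_2]_t.+1 := delta_mx 0 i.
have hw : (a *m w^T) 0 0 = 1.
  by rewrite trmx_delta -colE mxE [LHS]F2_eq_neq0 ai.
have swapA v : (v + w \in [predC A]) = (v \in A).
  rewrite !inE linearD /= mulmxDr mxE hw negbK.
  by rewrite (F2_eq_neq0 ((a *m v^T) 0 0)); case: ((a *m v^T) 0 0 != 0).
have cardA : #|A| = #|[predC A]|.
  rewrite -!sum1_card [RHS](reindex_inj (addIr w)).
  by apply: eq_bigl => v; rewrite swapA.
have := cardC A; rewrite -cardA card_mx card_Fp // mul1n expnS => cardT.
have cardA2 : (#|A| + #|A| = 2 * 2 ^ t)%N by [].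
by lia.
Qed.

Lemma simplex_code_subspace (t n : nat) (s : seq 'rV['F_2]_n)
    (P : 'rV['F_2]_n -> Prop) :
  size s = (2 ^ t)%N ->
  (forall l, subseq l s -> size l = (2 ^ (t - 1))%N -> P (\sum_(x <- l) x)) ->
  ~ P 0 ->
  exists2 U : {vspace 'rV['F_2]_n}, \dim U = t &
    forall u, u \in U -> u != 0 -> P u.
Proof.
move=> sz_s Ps nP0.
pose x (v : 'rV['F_2]_t) := nth 0 s (index v (enum {: 'rV['F_2]_t})).
have def_s : s = [seq x v | v <- enum {: 'rV['F_2]_t}].
  have sz_e : size (enum {: 'rV['F_2]_t}) = (2 ^ t)%N.
    by rewrite -cardE card_mx card_Fp // mul1n.
  apply: (@eq_from_nth _ 0) => [|i lti]; first by rewrite size_map sz_e.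
  rewrite sz_s in lti; rewrite (nth_map 0) ?sz_e // /x index_uniq ?sz_e //.
  exact: enum_uniq.
pose G := \sum_(v : 'rV['F_2]_t) v^T *m x v.
have mulG a : a *m G = \sum_(v | (a *m v^T) 0 0 != 0) x v.
  rewrite mulmx_sumr [RHS]big_mkcond; apply: eq_bigr => v _.
  rewrite mulmxA (mx11_scalar (a *m v^T)) mul_scalar_mx [X in X *: _]F2_eq_neq0.
  by rewrite !mxE eqxx mulr1n; case: ifP => _; rewrite ?scale1r ?scale0r.
have PG a : a != 0 -> P (a *m G).
  move=> a0; rewrite mulG -big_enum -(big_map x xpredT id) /=.
  apply: Ps; last by rewrite size_map -cardE card_nonzero_functional.
  (* The support of the functional is listed in the order of [enum], so its image is a subsequence
     of [s]. *)
  by rewrite [X in subseq _ X]def_s; apply: map_subseq; rewrite {1}/enum_mem -enumT filter_subseq.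
pose f := linfun (mulmxr G : 'rV_t -> 'rV_n).
have fE a : f a = a *m G by rewrite lfunE.
(* A nonzero [a] in the kernel would give [P 0]; hence [f] is injective and its image has dimension
   exactly [t]. *)
exists (f @: fullv)%VS.
  rewrite limg_dim_eq ?dimvf /dim /= ?mul1n //.
  have /eqP-> : lker f == 0%VS; last by rewrite capv0.
  rewrite -subv0; apply/subvP=> a; rewrite memv_ker memv0 fE => /eqP aG0.
  by apply/negP=> /negP /PG; rewrite aG0.
move=> _ /memv_imgP[a _ ->]; rewrite fE => aG; apply: PG.
by apply: contraNneq aG => ->; rewrite mul0mx.
Qed.

(* Two sums that differ in a single summand cannot both vanish. *)
Lemma nonzero_sum_subseq (V : zmodType) (r : nat) (s : seq V) :
  uniq s -> (0 < r)%N -> (r < size s)%N ->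
  exists l, [/\ subseq l s, size l = r & \sum_(x <- l) x != 0].
Proof.
case: r s => // r [|x [|y s]] // Us _ lt_rs.
have sz_take : size (take r s) = r by apply: size_takel.
have sub_y : subseq (y :: take r s) (y :: s) by rewrite /= eqxx take_subseq.
have sub_x : subseq (x :: take r s) (x :: y :: s).
  rewrite /= eqxx; exact: subseq_trans (take_subseq _ _) (subseq_cons _ _).
have [sum_x|] := eqVneq (\sum_(z <- x :: take r s) z) 0; last first.
  by exists (x :: take r s); rewrite /= sz_take.
exists (y :: take r s); split; rewrite /= ?sz_take //.
  exact: subseq_trans sub_y (subseq_cons _ _).
apply: contraTneq Us => sum_y; rewrite /= inE.
suff -> : x = y by rewrite eqxx.
move: sum_x sum_y; rewrite !big_cons => sum_x sum_y.
by apply: (addIr (\sum_(z <- take r s) z)); rewrite sum_x sum_y.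
Qed.

(** * From hypergraphs to flats *)

Lemma vs_ramsey_property_of_hypergraph (t k n : nat) : (2 <= t)%N ->
  hypergraph_ramsey (2 ^ (t - 1)) (2 ^ t) k.+1 (2 ^ n) ->
  vs_ramsey_property t k n.
Proof.
move=> ht ramN chi.
(* [insub] fails only at 0, so [None] is the extra colour. *)
pose col (u : 'rV['F_2]_n) := omap chi (insub u).
have [||s [c [sub_s sz_s hom_s]]] := ramN _ (option 'I_k)
    (fun l => col (\sum_(x <- l) x)) (enum {: 'rV['F_2]_n}) _ (enum_uniq _).
- by rewrite card_option card_ord.
- by rewrite -cardE card_mx card_Fp // mul1n.
have Us : uniq s := subseq_uniq sub_s (enum_uniq _).
case: c hom_s => [c|] hom_s.
  have [|U dimU colU] :=
    @simplex_code_subspace t n s (fun u => col u = Some c) sz_s hom_s.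
    by rewrite /col insubF // eqxx.
  exists (fun p => val p \in U); first by exists U.
  by exists c => p Up; have := colU _ Up (valP p); rewrite /col valK => -[].
(* If the common colour were [None], all these sums would vanish, although 2^(t-1) < 2^t leaves room
   for a nonzero one. *)
have [||l [sub_l sz_l l_neq0]] := @nonzero_sum_subseq _ (2 ^ (t - 1)) s Us.
- by rewrite expn_gt0.
- by rewrite sz_s ltn_exp2l //; lia.
by have := hom_s l sub_l sz_l; rewrite /col insubT.
Qed.

(** * Passage to real towers and logarithms *)

Lemma natr_tower (R : realType) (i y : nat) :
  (tower i y)%:R = iter i (fun z : R => 2 `^ z) y%:R.
Proof. by elim: i => //= i <-; rewrite powR_mulrn // natrX. Qed.

Lemma ler_iter_powR (R : realType) (i : nat) (x y : R) : x <= y ->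
  iter i (fun z : R => 2 `^ z) x <= iter i (fun z : R => 2 `^ z) y.
Proof. by move=> le_xy; elim: i => //= i IHi; rewrite ler_powR // ler1n. Qed.

Lemma trunc_log_le_log2 (R : realType) (k : nat) : (0 < k)%N ->
  (trunc_log 2 k)%:R <= log2 (k%:R : R).
Proof.
move=> k_gt0; have ln2_gt0 : 0 < ln (2 : R) by rewrite ln_gt0 // ltr1n.
rewrite /log2 ler_pdivlMr // mulr_natl -lnXn // ler_ln ?posrE ?exprn_gt0 ?ltr0n //.
by rewrite -natrX ler_nat trunc_logP.
Qed.

Theorem theorem1p1 (R : realType) (t : nat) (ht : (2 <= t)%N) :
  let r := (2 ^ (t - 1))%N in
  exists2 c : R, 0 < c &
    forall k : nat, (2 <= k)%N ->
      exists2 N : nat, is_vs_ramsey_number t k N &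
        N%:R <= twr (r - 1) (c * k%:R * log2 k%:R).
Proof.
move=> r; have [i def_r] : exists i, r = i.+2.
  have : (2 ^ 1 <= r)%N by rewrite leq_pexp2l //; lia.
  by case: r => [|[|i]] // _; exists i.
have [|C C_gt0 ramC] := @hypergraph_ramsey_tower i (2 ^ t).
  by rewrite expn_gt0.
(* The 4 comes from [L <= 2 * trunc_log 2 k] and [k.+1 <= 2 * k], both valid for k >= 2. *)
exists (4 * C)%:R; first by rewrite ltr0n muln_gt0.
move=> k k_ge2; pose L := (trunc_log 2 k).+1.
have ltkL : (k < 2 ^ L)%N by apply: trunc_log_ltn.
(* The space has 2^n vectors, which absorbs one of the [i.+1] exponentials of the hypergraph
   bound. *)
pose n := tower i (C * (L * k.+1)).
have ram_n : vs_ramsey_property t k n.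
  apply: vs_ramsey_property_of_hypergraph => //.
  by rewrite -/r def_r; apply: ramC.
have ex_n : exists n, `[< vs_ramsey_property t k n >] by exists n; apply/asboolP.
case: (ex_minnP ex_n) => N /asboolP ramN minN.
exists N; first by split=> // n' ram_n'; apply/minN/asboolP.
apply: (@le_trans _ _ n%:R); first by rewrite ler_nat minN //; apply/asboolP.
rewrite def_r subn1 /twr /= natr_tower; apply: ler_iter_powR.
have log_ge1 : (1 <= trunc_log 2 k)%N by rewrite trunc_log_max.
apply: (@le_trans _ _ ((4 * C)%:R * k%:R * (trunc_log 2 k)%:R)).
  rewrite -!natrM ler_nat -!mulnA (mulnCA 4) leq_mul2l; apply/orP; right.
  by rewrite /L; nia.
by rewrite ler_wpM2l ?mulr_ge0 ?ler0n // trunc_log_le_log2 //; lia.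
Qed.
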